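(* Let $M$ be a matroid on a finite ground set $E$, let $k\geq 2$ be an integer, let $B_1,\dots,B_k$ be bases of $M$, and let $A_1\subset B_1$. Then there exist subsets $A_2\subset B_2,\dots,A_k\subset B_k$ such that for every $i\in\{1,\dots,k\}$ the set $(B_i\setminus A_i)\cup A_{i-1}$ is a basis of $M$, where indices are taken cyclically, i.e. $A_0:=A_k$.
   Context: The bases $B_1,\dots,B_k$ need not be distinct or disjoint. The sets $(B_i\setminus A_i)\cup A_{i-1}$ are those obtained by cyclically shifting the subsets $A_i$ by one position. *)

(* Defs.v *)
From mathcomp Require Import all_boot.

Set Implicit Arguments.
Unset Strict Implicit.
Unset Printing Implicit Defensive.

Record matroid (E : finType) := Matroid {
  indep : pred {set E};
  indep0 : indep set0;
  indepS : forall I J : {set E}, I \subset J -> indep J -> indep I;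
  indep_aug : forall I J : {set E}, indep I -> indep J -> #|I| < #|J| ->
    exists2 x, x \in J :\: I & indep (x |: I)
}.

Definition basis (E : finType) (M : matroid E) (B : {set E}) : bool :=
  maxset (indep M) B.

(* Main.v *)
Require Import Defs.
From mathcomp Require Import all_boot zify.

Set Implicit Arguments.
Unset Strict Implicit.
Unset Printing Implicit Defensive.

(** Put [Q = B_1 \ A_1]. Choosing [A_2, ..., A_k] greedily works: if [A_(i-1)]
    and [Q] partition a basis, the symmetric subset exchange property for that
    basis and [B_i] yields [A_i] such that both [(B_i \ A_i) :|: A_(i-1)] and
    [A_i :|: Q] are bases. The last [A_k :|: Q] is the missing condition at
    [i = 1]. The exchange property follows from submodularity of the rank, by
    distributing the elements of [B_i] one at a time between the two sides. *)

Section Rank.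

Variables (E : finType) (M : matroid E).
Implicit Types (B I J P Q S X Y Z : {set E}).

Definition rank X := \max_(I : {set E} | indep M I && (I \subset X)) #|I|.

Lemma leq_rank_indep I X : indep M I -> I \subset X -> #|I| <= rank X.
Proof.
move=> indI sIX.
by apply: (@leq_bigmax_cond _ _ (fun I : {set E} => #|I|)); rewrite indI.
Qed.

Lemma rank_witness X : exists2 I, indep M I && (I \subset X) & rank X = #|I|.
Proof.
have [|I PI eqI] := @eq_bigmax_cond _ [pred I | indep M I && (I \subset X)]
  (fun I : {set E} => #|I|); last by exists I; rewrite -?eqI.
by apply/card_gt0P; exists set0; rewrite inE indep0 sub0set.
Qed.

Lemma rankS X Y : X \subset Y -> rank X <= rank Y.
Proof.
move=> sXY; have [I /andP[indI sIX] ->] := rank_witness X.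
exact: leq_rank_indep indI (subset_trans sIX sXY).
Qed.

Lemma rank_leq_card X : rank X <= #|X|.
Proof. by have [I /andP[_ sIX] ->] := rank_witness X; exact: subset_leq_card. Qed.

Lemma rank_indep I : indep M I -> rank I = #|I|.
Proof. by move=> indI; apply/eqP; rewrite eqn_leq rank_leq_card leq_rank_indep. Qed.

(** A maximal independent set between [I] and [X] already has rank many elements, for a larger
    witness would augment it inside [X]. *)
Lemma rank_extend I X : indep M I -> I \subset X ->
  exists J, [/\ I \subset J, J \subset X, indep M J & #|J| = rank X].
Proof.
move=> indI sIX.
have [|J /maxsetP[/andP[indJ sJX] maxJ] sIJ] :=
  @maxset_exists _ [pred J | indep M J && (J \subset X)] I.
  by rewrite inE indI.
exists J; split=> //; apply/eqP; rewrite eqn_leq leq_rank_indep //= leqNgt.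
have [K /andP[indK sKX] ->] := rank_witness X.
apply/negP => /(indep_aug indJ indK)[x]; rewrite inE => /andP[xNJ xK] indxJ.
have eqJ : x |: J = J.
  apply: maxJ (subsetUr _ _); rewrite inE indxJ subUset sub1set sJX andbT.
  exact: subsetP sKX _ xK.
by rewrite -eqJ setU11 in xNJ.
Qed.

(** Extend a largest independent [I] of [X :&: Y] to a largest independent [J] of [X :|: Y]; the
    traces of [J] on [X] and [Y] cover [J] and share at least [I]. *)
Lemma rank_submod X Y : rank (X :|: Y) + rank (X :&: Y) <= rank X + rank Y.
Proof.
have [I /andP[indI sI] ->] := rank_witness (X :&: Y).
have sIU : I \subset X :|: Y.
  exact: subset_trans sI (subset_trans (subsetIl _ _) (subsetUl _ _)).
have [J [sIJ sJ indJ <-]] := rank_extend indI sIU.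
have le_rank Z : #|J :&: Z| <= rank Z.
  by apply: leq_rank_indep (subsetIr _ _); apply: indepS indJ; exact: subsetIl.
apply: leq_trans (leq_add (le_rank X) (le_rank Y)).
rewrite -(cardsUI (J :&: X)) -setIUr (setIidPl sJ) leq_add2l -setIIr.
by apply: subset_leq_card; rewrite subsetI sIJ.
Qed.

(** Turns maximality into two numerical equalities, so that bases can be recognised by counting. *)
Lemma basisE B : basis M B = (#|B| == rank setT) && (rank B == rank setT).
Proof.
apply/idP/andP => [/maxsetP[indB maxB] | [/eqP cB /eqP rB]].
  have [J [sBJ _ indJ cJ]] := rank_extend indB (subsetT B).
  by rewrite (rank_indep indB) -cJ (maxB J) ?eqxx.
have [I /andP[indI sIB] rI] := rank_witness B.
have eqIB : I = B by apply/eqP; rewrite eqEcard sIB -rI rB cB leqnn.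
rewrite {I sIB rI}eqIB in indI; apply/maxsetP; split=> // J indJ sBJ.
by apply/eqP; rewrite eq_sym eqEcard sBJ cB leq_rank_indep ?subsetT.
Qed.

(* This is the induction behind the two-matroid covering theorem: if [e] could
   join neither [P] nor [Q], adding the two violated inequalities, at [Z1] and
   [Z2], would contradict the hypothesis at [e |: Z1 :|: Z2] and [Z1 :&: Z2]. *)
Lemma rank_split S P Q c :
    (forall Z, Z \subset S -> c + #|Z| <= rank (P :|: Z) + rank (Q :|: Z)) ->
  exists2 X : {set E}, X \subset S & c + #|S| <= rank (P :|: (S :\: X)) + rank (Q :|: X).
Proof.
move=> hyp; have [n] := ubnP #|S|; elim: n => // n IHn in S P Q c hyp *.
rewrite ltnS => leSn.
have [S0 | [e eS]] := set_0Vmem S.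
  by exists set0; [exact: sub0set | rewrite setD0 S0 hyp ?sub0set].
have cS : #|S| = #|S :\ e|.+1 by rewrite (cardsD1 e) eS.
have ltSn : #|S :\ e| < n by rewrite -cS.
(* Moving [e] from [S] to the side of [P] raises the constant to [c.+1], which keeps the target
   [c + #|S|] unchanged. *)
case: (boolP [forall (Z : {set E} | Z \subset S :\ e),
    c.+1 + #|Z| <= rank (e |: P :|: Z) + rank (Q :|: Z)]) => [/forall_inP hP|].
  have [X sX leX] := IHn _ _ _ _ hP ltSn; move: sX; rewrite subsetD1 => /andP[sXS eNX].
  exists X => //; move: leX; rewrite cS addSnnS => /leq_trans -> //.
  rewrite leq_add2r rankS //; apply/subsetP => x; rewrite !inE.
  by have [->|] := eqVneq x e; rewrite ?eS ?eNX ?orbT.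
rewrite negb_forall => /existsP[Z1]; rewrite negb_imply -ltnNge => /andP[sZ1 lt1].
case: (boolP [forall (Z : {set E} | Z \subset S :\ e),
    c.+1 + #|Z| <= rank (P :|: Z) + rank (e |: Q :|: Z)]) => [/forall_inP hQ|].
  have [X sX leX] := IHn _ _ _ _ hQ ltSn; move: sX; rewrite subsetD1 => /andP[sXS eNX].
  exists (e |: X); first by rewrite subUset sub1set eS.
  move: leX; rewrite cS addSnnS => /leq_trans -> //.
  apply: leq_add; apply: rankS; apply/subsetP => x; rewrite !inE.
    by case: (x == e); rewrite ?andbF.
  by case: (x == e); rewrite ?orbT.
rewrite negb_forall => /existsP[Z2]; rewrite negb_imply -ltnNge => /andP[sZ2 lt2].
move: sZ1 sZ2; rewrite !subsetD1 => /andP[sZ1 eZ1] /andP[sZ2 eZ2].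
have hU : c + #|Z1 :|: Z2|.+1 <=
    rank (P :|: (e |: (Z1 :|: Z2))) + rank (Q :|: (e |: (Z1 :|: Z2))).
  have -> : #|Z1 :|: Z2|.+1 = #|e |: (Z1 :|: Z2)|.
    by rewrite cardsU1 inE negb_or eZ1 eZ2.
  by apply: hyp; rewrite !subUset sub1set eS sZ1.
have hI := hyp _ (subset_trans (subsetIl Z1 Z2) sZ1).
(* [Y1] belongs to the set that receives [e]; hence [Z1] and [Z2] swap roles between [T = P] and
   [T = Q]. *)
have submod T Y1 Y2 : e \notin Y1 -> e \notin Y2 ->
    rank (T :|: (e |: (Y1 :|: Y2))) + rank (T :|: (Y1 :&: Y2)) <=
    rank (e |: T :|: Y1) + rank (T :|: Y2).
  move=> eY1 eY2; apply: leq_trans (rank_submod _ _).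
  apply: leq_add; apply: rankS; apply/subsetP => x; rewrite !inE;
    by case: (x == e); case: (x \in T); case: (x \in Y1); case: (x \in Y2).
have subP := submod P _ _ eZ1 eZ2.
have := submod Q _ _ eZ2 eZ1; rewrite (setUC Z2) (setIC Z2) => subQ.
have := cardsUI Z1 Z2; lia.
Qed.

Lemma basis_subset_exchange B P Q :
    basis M B -> basis M (P :|: Q) -> #|P| + #|Q| = #|B| ->
  exists X : {set E}, [/\ X \subset B, basis M ((B :\: X) :|: P), basis M (X :|: Q)
               & #|X| = #|P|].
Proof.
move=> bB bPQ cPQ; have /andP[/eqP cB _] := etrans (esym (basisE B)) bB.
have /andP[_ /eqP rPQ] := etrans (esym (basisE _)) bPQ.
have indB : indep M B by case/maxsetP: bB.
have [Z sZB|X sXB leX] := @rank_split B P Q #|B|.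
  (* By submodularity: the union contains the basis [P :|: Q], and the intersection contains the
     independent set [Z]. *)
  have := rank_submod (P :|: Z) (Q :|: Z).
  have -> : #|Z| = rank Z by rewrite rank_indep // (indepS sZB).
  apply: leq_trans; apply: leq_add; last first.
    by apply: rankS; rewrite subsetI !subsetUr.
  rewrite cB -rPQ; apply: rankS; apply: setUSS; exact: subsetUl.
have cDX : #|B :\: X| + #|X| = #|B|.
  by rewrite cardsD (setIidPr sXB) subnK // subset_leq_card.
(* The two ranks sum to at least [#|B| + #|B|] and neither exceeds [#|B|], so both are full. The
   cardinals of the four pieces sum to the same value, so both unions have exactly [#|B|]
   elements. *)
have r1 := rankS (subsetT (P :|: (B :\: X))).
have r2 := rankS (subsetT (Q :|: X)).
have c1 := rank_leq_card (P :|: (B :\: X)).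
have c2 := rank_leq_card (Q :|: X).
have u1 := (cardsU P (B :\: X)); have u2 := cardsU Q X.
exists X; split=> //; last by lia.
  by rewrite basisE setUC; apply/andP; split; apply/eqP; lia.
by rewrite basisE setUC; apply/andP; split; apply/eqP; lia.
Qed.

Lemma basis_exchange_chain (B : nat -> {set E}) (A Q : {set E}) :
    (forall n, basis M (B n)) -> A \subset B 0 -> Q = B 0 :\: A ->
  exists a : nat -> {set E},
    [/\ a 0 = A, forall n, a n \subset B n,
        forall n, basis M ((B n.+1 :\: a n.+1) :|: a n)
      & forall n, basis M (Q :|: a n)].
Proof.
move=> bB sAB defQ.
pose good n P X := [&& X \subset B n, basis M ((B n :\: X) :|: P),
  basis M (X :|: Q) & #|X| == #|P|].
(* Step [i] picks a subset of [B i.+1]. The default [set0] is never reached: [aS] and the invariant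
   [aP] show that each pick succeeds. *)
pose a n := iteri n (fun i P => odflt set0 [pick X | good i.+1 P X]) A.
have cAQ n : #|A| + #|Q| = #|B n|.
  have cB i : #|B i| = rank setT by have := bB i; rewrite basisE => /andP[/eqP].
  by rewrite cB -(cB 0) defQ cardsD (setIidPr sAB) subnKC // subset_leq_card.
have aS n : basis M (a n :|: Q) -> #|a n| = #|A| -> good n.+1 (a n) (a n.+1).
  move=> bQ ca; rewrite /a iteriS -/(a n); case: pickP => //= noX.
  have [|X [sX bX1 bX2 cX]] := basis_subset_exchange (bB n.+1) bQ.
    by rewrite ca.
  by have := noX X; rewrite /good sX bX1 bX2 cX eqxx.
have aP n : [/\ a n \subset B n, basis M (a n :|: Q) & #|a n| = #|A|].
  elim: n => [|n [_ bQ ca]].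
    have AQ : A :|: Q = B 0 by rewrite defQ -{1}(setIidPr sAB) setID.
    by rewrite /a /= AQ.
  by have /and4P[-> _ -> /eqP->] := aS n bQ ca.
exists a; split=> // n; have [sa bQ ca] := aP n => //.
  by have /and4P[] := aS n bQ ca.
by rewrite setUC.
Qed.

End Rank.

Theorem theorem1 (E : finType) (M : matroid E) (k : nat) (k_ge2 : 2 <= k)
    (B : 'I_k -> {set E}) (basisB : forall i : 'I_k, basis M (B i))
    (A1 : {set E}) (sA1B1 : A1 \subset B (Ordinal (ltnW k_ge2))) :
  exists A : 'I_k -> {set E},
    [/\ A (Ordinal (ltnW k_ge2)) = A1,
        forall i : 'I_k, A i \subset B i
      & forall i : 'I_k, basis M ((B i :\: A i) :|: A (ord_pred i))].
Proof.
set i0 := Ordinal (ltnW k_ge2) in sA1B1 *.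
(* Indices from [k] on fall back to [i0], so every [Bn n] is a basis and the infinite chain
   applies. *)
pose Bn n := B (insubd i0 n).
have BnE (i : 'I_k) : Bn i = B i by rewrite /Bn valKd.
have Bn0 : Bn 0 = B i0 := BnE i0.
have [||a [a0 sa bS bQ]] := @basis_exchange_chain E M Bn A1 _ _ _ erefl.
- by move=> n; exact: basisB.
- by rewrite Bn0.
exists (fun i => a i); split=> // i; first by rewrite -BnE.
(* At index 0 the predecessor is the last index, and [bQ] closes the cycle. *)
case: i => [[|n] ltn].
  by rewrite (_ : Ordinal ltn = i0) -?Bn0 ?a0 //; apply: val_inj.
have -> : ord_pred (Ordinal ltn) = n :> nat.
  by rewrite /= modnDr modn_small // ltnW.
by rewrite -BnE; exact: bS.
Qed.
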